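(* Let $p,q$ be coprime integers with $q\ge 1$, and let $F(x,\mu)$ be a family of lifts in class $\mathcal{R}_{p,q}$ in a neighbourhood $|\mu|<\mu_0$ of $\mu=0$, i.e. $$F(x,\mu)=x+\frac{p}{q}+\mu\,(a+\psi(x))+\mu^2 g(x,\mu),\qquad |\mu|<\mu_0,$$ with $a>0$. Let $\rho(\mu)=\rho(F(\cdot,\mu))$. If $\min_{x\in[0,1]}(a+\psi(x))>0$, then $\rho(\mu)$ is differentiable at $\mu=0$ with derivative $$\rho'(0)=T_0^{-1},\qquad T_0=\int_0^1\frac{1}{a+\Psi(x)}\,dx,$$ where $\Psi(x)=\sum_{n\in\mathbb{Z}\setminus\{0\}}c_{nq}e^{2\pi i nqx}$ and $(c_m)_{m\in\mathbb{Z}}$ are the Fourier coefficients of $\psi$.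
   Context: A lift of an orientation preserving circle homeomorphism is a continuous increasing function $F:\mathbb{R}\to\mathbb{R}$ with $F(x+1)=F(x)+1$. Its rotation number is $\rho(F)=\lim_{n\to\infty}\frac1n(F^n(x)-x)$, where $F^n$ is the $n$-fold composition; the limit exists and does not depend on $x$. A family of lifts $F(x,\mu)$ (for each $\mu$, $x\mapsto F(x,\mu)$ is a lift of an orientation preserving circle homeomorphism) is in class $\mathcal{R}_{p,q}$ in a neighbourhood of $\mu=0$ if there exists $\mu_0>0$ such that for all $|\mu|<\mu_0$, $F(x,\mu)=x+\frac{p}{q}+\mu(a+\psi(x))+\mu^2g(x,\mu)$, where $p$ and $q$ are coprime, $a$ is a real constant, $\psi$ is a real $C^1$ function, periodic with period one, with $\int_0^1\psi(x)\,dx=0$, and $g(x,\mu)$ is bounded, continuous in $\mu$, and for each $\mu\in(-\mu_0,\mu_0)$ is a $C^1$ function of $x$, periodic with period one. Primes on $\rho$ denote derivatives with respect to $\mu$. The Fourier coefficients are $c_m=\int_0^1\psi(x)e^{-2\pi i mx}\,dx$. *)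

(* Defs.v *)
From Stdlib Require Import Reals ZArith Znumtheory Lra Lia.
From Coquelicot Require Import Coquelicot.
Open Scope R_scope.

Definition is_lift (F : R -> R) : Prop :=
  (forall x, continuous F x) /\
  (forall x y, x < y -> F x < F y) /\
  (forall x, F (x + 1) = F x + 1).

(* The base point 0 is immaterial: see [rotation_number_correct] below. *)
Definition rotation_number (F : R -> R) : R :=
  real (Lim_seq (fun n => (Nat.iter n F 0 - 0) / INR n)).

Lemma lift_add_nat (F : R -> R) (HF : is_lift F) (k : nat) (x : R) :
  F (x + INR k) = F x + INR k.
Proof.
destruct HF as [_ [_ H1]].
induction k as [|k IH].
- simpl; rewrite !Rplus_0_r; reflexivity.
- rewrite S_INR, <- !Rplus_assoc, H1, IH; reflexivity.
Qed.

Lemma lift_add_Z (F : R -> R) (HF : is_lift F) (k : Z) (x : R) :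
  F (x + IZR k) = F x + IZR k.
Proof.
destruct (Z_le_gt_dec 0 k) as [Hk|Hk].
- rewrite <- (Z2Nat.id k Hk), <- INR_IZR_INZ.
  apply lift_add_nat; assumption.
- assert (E : IZR k = - INR (Z.to_nat (- k))).
  { rewrite INR_IZR_INZ, Z2Nat.id, opp_IZR by lia; ring. }
  rewrite E.
  pose proof (lift_add_nat F HF (Z.to_nat (- k))
                (x + - INR (Z.to_nat (- k)))) as H.
  replace (x + - INR (Z.to_nat (- k)) + INR (Z.to_nat (- k))) with x in H
    by ring.
  lra.
Qed.

Lemma iter_lift_periodic (F : R -> R) (HF : is_lift F) (n : nat) (k : Z)
  (x : R) : Nat.iter n F (x + IZR k) = Nat.iter n F x + IZR k.
Proof.
induction n as [|n IH]; simpl; [reflexivity|].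
rewrite IH; apply lift_add_Z; assumption.
Qed.

Lemma iter_lift_le (F : R -> R) (HF : is_lift F) (n : nat) (x y : R) :
  x <= y -> Nat.iter n F x <= Nat.iter n F y.
Proof.
intros Hxy; induction n as [|n IH]; simpl; [assumption|].
destruct HF as [_ [HF _]].
destruct IH as [IH|IH]; [left; apply HF; assumption | rewrite IH; right; reflexivity].
Qed.

Lemma iter_lift_displacement (F : R -> R) (HF : is_lift F) (n : nat) (x : R) :
  Rabs (Nat.iter n F x - x - Nat.iter n F 0) <= 1.
Proof.
destruct (archimed x) as [H1 H2].
set (k := up x) in *.
pose proof (iter_lift_periodic F HF n k 0) as E1.
pose proof (iter_lift_periodic F HF n (k - 1) 0) as E2.
rewrite minus_IZR in E2.
assert (L1 := iter_lift_le F HF n x (0 + IZR k) ltac:(lra)).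
assert (L2 := iter_lift_le F HF n (0 + (IZR k - 1)) x ltac:(lra)).
apply Rabs_le; lra.
Qed.

Lemma iter_lift_mul (F : R -> R) (HF : is_lift F) (n m : nat) :
  Rabs (Nat.iter (n * m) F 0 - INR n * Nat.iter m F 0) <= INR n.
Proof.
induction n as [|n IH].
- simpl; rewrite Rmult_0_l, Rminus_0_r, Rabs_R0; lra.
- change (S n * m)%nat with (m + n * m)%nat.
  rewrite Nat.iter_add, S_INR.
  pose proof (iter_lift_displacement F HF m (Nat.iter (n * m) F 0)) as H.
  apply Rabs_le_between in H; apply Rabs_le_between in IH.
  apply Rabs_le; lra.
Qed.

Lemma rotation_number_correct (F : R -> R) (HF : is_lift F) (x : R) :
  is_lim_seq (fun n => (Nat.iter n F x - x) / INR n) (rotation_number F).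
Proof.
set (u := fun n => Nat.iter n F 0 / INR n).
assert (Hu : forall n m, (0 < n)%nat -> (0 < m)%nat ->
               Rabs (u n - u m) <= / INR n + / INR m).
{ intros n m Hn Hm.
  apply lt_0_INR in Hn; apply lt_0_INR in Hm.
  pose proof (iter_lift_mul F HF n m) as A.
  pose proof (iter_lift_mul F HF m n) as B.
  rewrite Nat.mul_comm in B.
  apply Rabs_le_between in A; apply Rabs_le_between in B.
  replace (u n - u m)
    with ((INR m * Nat.iter n F 0 - INR n * Nat.iter m F 0)
            * (/ INR n * / INR m)) by (unfold u; field; lra).
  replace (/ INR n + / INR m) with ((INR n + INR m) * (/ INR n * / INR m))
    by (field; lra).
  assert (0 < / INR n * / INR m)
    by (apply Rmult_lt_0_compat; apply Rinv_0_lt_compat; assumption).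
  rewrite Rabs_mult, (Rabs_pos_eq (/ INR n * / INR m)) by lra.
  apply Rmult_le_compat_r; [lra|].
  apply Rabs_le; lra. }
assert (Hinv : is_lim_seq (fun n => / INR n) 0).
{ apply (is_lim_seq_inv INR p_infty); [apply is_lim_seq_INR | discriminate]. }
assert (Hcv : ex_finite_lim_seq u).
{ apply ex_lim_seq_cauchy_corr; intros eps.
  apply is_lim_seq_spec in Hinv.
  destruct (Hinv (pos_div_2 eps)) as [N HN].
  exists (S N); intros n m Hn Hm.
  pose proof (HN n ltac:(lia)) as An; pose proof (HN m ltac:(lia)) as Am.
  simpl in An, Am.
  apply Rabs_def2 in An; apply Rabs_def2 in Am.
  pose proof (Hu n m ltac:(lia) ltac:(lia)); lra. }
assert (E : rotation_number F = real (Lim_seq u)).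
{ unfold rotation_number; f_equal; apply Lim_seq_ext; intros n.
  unfold u; rewrite Rminus_0_r; reflexivity. }
apply Lim_seq_correct' in Hcv; rewrite <- E in Hcv.
apply (is_lim_seq_ext
  (fun n => u n + (Nat.iter n F x - x - Nat.iter n F 0) / INR n)).
{ intros n; unfold u, Rdiv; ring. }
replace (Finite (rotation_number F)) with (Finite (rotation_number F + 0))
  by (f_equal; ring).
apply is_lim_seq_plus'; [assumption|].
apply is_lim_seq_abs_0.
apply (is_lim_seq_le_le_loc (fun _ => 0) _ (fun n => / INR n));
  [|apply is_lim_seq_const|assumption].
exists 1%nat; intros n Hn.
apply le_INR in Hn; simpl in Hn.
pose proof (iter_lift_displacement F HF n x) as H.
split; [apply Rabs_pos|].
unfold Rdiv; rewrite Rabs_mult, (Rabs_pos_eq (/ INR n)).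
- rewrite <- (Rmult_1_l (/ INR n)) at 2.
  apply Rmult_le_compat_r; [left; apply Rinv_0_lt_compat; lra | assumption].
- left; apply Rinv_0_lt_compat; lra.
Qed.

Definition is_C1 (f : R -> R) : Prop :=
  (forall x, ex_derive f x) /\ (forall x, continuous (Derive f) x).

Definition periodic1 (f : R -> R) : Prop := forall x, f (x + 1) = f x.

(* [F] is in class R_{p,q} on |mu| < mu0, with the data a, psi, g of its
   expansion made explicit.  [F x mu] and [g x mu] are unconstrained for
   |mu| >= mu0. *)
Record in_class_R (p q : Z) (F : R -> R -> R)
    (mu0 a : R) (psi : R -> R) (g : R -> R -> R) : Prop := {
  class_coprime : rel_prime p q;
  class_mu0_pos : 0 < mu0;
  class_lift : forall mu, Rabs mu < mu0 -> is_lift (fun x => F x mu);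
  class_expansion : forall x mu, Rabs mu < mu0 ->
    F x mu = x + IZR p / IZR q + mu * (a + psi x) + mu ^ 2 * g x mu;
  class_psi_C1 : is_C1 psi;
  class_psi_periodic : periodic1 psi;
  class_psi_mean : RInt psi 0 1 = 0;
  class_g_bounded : exists M, forall x mu, Rabs mu < mu0 -> Rabs (g x mu) <= M;
  class_g_continuous : forall x mu, Rabs mu < mu0 ->
    continuous (fun nu => g x nu) mu;
  class_g_C1 : forall mu, Rabs mu < mu0 -> is_C1 (fun x => g x mu);
  class_g_periodic : forall mu, Rabs mu < mu0 -> periodic1 (fun x => g x mu)
}.

Definition is_min_on (f : R -> R) (u v m : R) : Prop :=
  (exists x, u <= x <= v /\ f x = m) /\ (forall x, u <= x <= v -> m <= f x).

Definition CInt (f : R -> C) (u v : R) : C :=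
  RInt (V := C_R_CompleteNormedModule) f u v.

(* exp (i t) *)
Definition cis (t : R) : C := (cos t, sin t).

Definition fourier_coeff (psi : R -> R) (m : Z) : C :=
  CInt (fun x => RtoC (psi x) * cis (- (2 * PI * IZR m * x)))%C 0 1.

(* Sum over the nonzero integers: both one-sided series converge. *)
Definition is_series_Znz (b : Z -> C) (l : C) : Prop :=
  exists lp ln : C,
    is_series (V := C_R_NormedModule) (fun k => b (Z.of_nat (S k))) lp /\
    is_series (V := C_R_NormedModule) (fun k => b (- Z.of_nat (S k))%Z) ln /\
    l = (lp + ln)%C.

Definition Series_Znz (b : Z -> C) : C :=
  iota (T := C_R_CompleteNormedModule) (is_series_Znz b).

Definition Psi (psi : R -> R) (q : Z) (x : R) : C :=
  Series_Znz (fun n =>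
    fourier_coeff psi (n * q) * cis (2 * PI * IZR (n * q) * x))%C.

(* The value is real because psi is; no real part is taken here. *)
Definition T0 (a : R) (psi : R -> R) (q : Z) : C :=
  CInt (fun x => 1 / (RtoC a + Psi psi q x))%C 0 1.

(* Main.v *)
Require Import Defs.
From Stdlib Require Import Reals ZArith Znumtheory Lra Lia.
From Stdlib Require Import FunctionalExtensionality.
From Coquelicot Require Import Coquelicot.
Open Scope R_scope.

(** Write [alpha = p/q] and let [avg] be the mean of [psi] over the orbit
    [x, x + alpha, ..., x + (q-1) alpha] of the rotation by [alpha].

    Dynamics.  To first order in [mu], [F(., mu)] is the rotation by [alpha]
    followed by a displacement [mu (a + psi)].  The average [avg] differs from
    [psi] by a coboundary, [u(x + alpha) - u(x) = avg(x) - psi(x)]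
    ([transfer_cohomological]), so the oscillating part [psi - avg] can be
    absorbed in a change of variable, and what remains is the displacement
    [mu (a + avg)], invariant under the rotation.  That displacement is
    straightened by the primitive [Phi] of [w = 1/(a + avg)].  Concretely
    [Theta = Phi + mu u w] satisfies
    [Theta(F x) = Theta x + alpha T + mu + O(mu^2)] uniformly in [x], where
    [T] is the integral of [w] over a period, and [Theta x - T x] is bounded.
    Summing along an orbit of [F] gives [T rho(mu) = alpha T + mu + O(mu^2)]
    ([rotation_number_expansion]), hence [rho'(0) = 1/T].  The errors are
    controlled by the fact that all functions involved are bounded and
    Lipschitz.

    Fourier analysis.  It remains to see that [Psi], defined by a Fourier
    series, is [avg], so that [T0 = T] ([Psi_orbit_average], [T0_RInt]).
    Since [p] and [q] are coprime, [avg] has period [1/q], so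
    [G(y) = avg(y/q)] has period one, and its [n]-th Fourier coefficient is the
    [nq]-th one of [psi].  It is therefore enough that the Fourier series of a
    differentiable periodic function converges to it, separately over positive
    and over negative frequencies ([fourier_series_converges]).  Dividing the
    increment [f(x + s) - f(x)] by [2 sin(pi s)] gives a continuous function
    [k] for [|s| <= 1/2], and the identity
    [2 sin(pi s) cos(2 pi n s + phi)
       = sin((2n+1) pi s + phi) - sin((2n-1) pi s + phi)]
    makes each one-sided series telescope: the partial sums are differences of
    coefficients of [k] along the orthogonal family [sin((2n+1) pi s + phi)],
    which tend to zero by Bessel's inequality. *)

(** * Periodic functions and their integrals *)

(** Lemmas on normed modules produce equations in the carrier of a module,
    which [ring], [field] and [lra] recognize only once it is exposed as [R]. *)
Ltac in_R :=
  lazymatch goal with |- @eq _ ?a ?b => change (@eq R a b) end.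

(** Stated with an increment [c] so that it applies both to periodic functions
    ([c = 0]) and to primitives of periodic functions. *)
Lemma quasi_periodic_nat (f : R -> R) (s c : R)
    (Hf : forall x, f (x + s) = f x + c) (n : nat) (x : R) :
  f (x + INR n * s) = f x + INR n * c.
Proof.
induction n as [|n IH].
- simpl; rewrite !Rmult_0_l, !Rplus_0_r; reflexivity.
- rewrite S_INR.
  replace (x + (INR n + 1) * s) with (x + INR n * s + s) by ring.
  rewrite Hf, IH; ring.
Qed.

Lemma quasi_periodic_Z (f : R -> R) (s c : R)
    (Hf : forall x, f (x + s) = f x + c) (k : Z) (x : R) :
  f (x + IZR k * s) = f x + IZR k * c.
Proof.
destruct (Z_le_gt_dec 0 k) as [Hk|Hk].
- rewrite <- (Z2Nat.id k Hk), <- INR_IZR_INZ.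
  apply quasi_periodic_nat; assumption.
- assert (E : IZR k = - INR (Z.to_nat (- k))).
  { rewrite INR_IZR_INZ, Z2Nat.id, opp_IZR by lia; ring. }
  pose proof (quasi_periodic_nat f s c Hf (Z.to_nat (- k)) (x + IZR k * s)) as H.
  replace (x + IZR k * s + INR (Z.to_nat (- k)) * s) with x in H
    by (rewrite E; ring).
  rewrite E in *; lra.
Qed.

Lemma periodic_Z (f : R -> R) (s : R)
    (Hf : forall x, f (x + s) = f x) (k : Z) (x : R) :
  f (x + IZR k * s) = f x.
Proof.
rewrite (quasi_periodic_Z f s 0); [ring|].
intros y; rewrite Hf; ring.
Qed.

(** By Bezout, [1/q] is an integer combination of the periods [p/q] and [1]. *)
Lemma periodic_inv_denominator (p q : Z) (f : R -> R)
    (Hq : (1 <= q)%Z) (Hpq : rel_prime p q)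
    (H1 : periodic1 f)
    (Hr : forall x, f (x + IZR p / IZR q) = f x) (x : R) :
  f (x + / IZR q) = f x.
Proof.
assert (Hq0 : 0 < IZR q) by (apply IZR_lt; lia).
destruct (rel_prime_bezout p q Hpq) as [u v Huv].
apply (f_equal IZR) in Huv; rewrite plus_IZR, !mult_IZR in Huv.
replace (x + / IZR q) with (x + IZR u * (IZR p / IZR q) + IZR v * 1).
- rewrite (periodic_Z f 1 H1), (periodic_Z f (IZR p / IZR q) Hr); reflexivity.
- apply (Rmult_eq_reg_r (IZR q)); [field_simplify; lra | lra].
Qed.

Lemma continuous_of_derivable (f : R -> R) (x : R) :
  ex_derive f x -> continuous f x.
Proof. apply (ex_derive_continuous (K := R_AbsRing) (V := R_NormedModule)). Qed.

Lemma ex_RInt_cont (f : R -> R) (a b : R) :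
  (forall x, continuous f x) -> ex_RInt f a b.
Proof.
intros H; apply (ex_RInt_continuous (V := R_CompleteNormedModule)).
intros; apply H.
Qed.

Lemma RInt_eq (f g : R -> R) (a b : R) :
  (forall x, f x = g x) -> RInt f a b = RInt g a b :> R.
Proof. intros H; apply RInt_ext; auto. Qed.

Lemma RInt_shift (f : R -> R) (a b s : R) (Hf : forall x, continuous f x) :
  RInt (fun x => f (x + s)) a b = RInt f (a + s) (b + s) :> R.
Proof.
pose proof (RInt_comp_lin (V := R_CompleteNormedModule) f 1 s a b) as H.
rewrite !Rmult_1_l in H; rewrite <- H by (apply ex_RInt_cont; assumption).
apply RInt_ext; intros x _.
change (f (x + s) = 1 * f (1 * x + s)); rewrite !Rmult_1_l; reflexivity.
Qed.

Lemma RInt_quasi_periodic (f : R -> R) (s x : R)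
    (Hf : forall x, continuous f x) (Hs : forall x, f (x + s) = f x) :
  RInt f 0 (x + s) = RInt f 0 x + RInt f 0 s :> R.
Proof.
assert (E : RInt f 0 x = RInt f s (x + s)).
{ rewrite <- (Rplus_0_l s) at 1; rewrite <- RInt_shift by assumption.
  apply RInt_ext; intros y _; symmetry; apply Hs. }
rewrite E, (Rplus_comm (RInt f s _)).
symmetry; apply (RInt_Chasles (V := R_CompleteNormedModule));
  apply ex_RInt_cont; assumption.
Qed.

Lemma RInt_period (f : R -> R) (s x : R)
    (Hf : forall x, continuous f x) (Hs : forall x, f (x + s) = f x) :
  RInt f x (x + s) = RInt f 0 s :> R.
Proof.
pose proof (RInt_quasi_periodic f s x Hf Hs) as E.
pose proof (RInt_Chasles (V := R_CompleteNormedModule) f 0 x (x + s)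
  (ex_RInt_cont f _ _ Hf) (ex_RInt_cont f _ _ Hf)) as C.
change (RInt f 0 x + RInt f x (x + s) = RInt f 0 (x + s)) in C; lra.
Qed.

(** After the substitution [y = q x] the integral is [1/q] times an integral
    over [q] periods. *)
Lemma RInt_dilate (f : R -> R) (q : Z) (Hq : (1 <= q)%Z)
    (Hf : forall x, continuous f x) (H1 : periodic1 f) :
  RInt (fun x => f (IZR q * x)) 0 1 = RInt f 0 1 :> R.
Proof.
assert (Hq0 : 0 < IZR q) by (apply IZR_lt; lia).
pose proof (RInt_comp_lin (V := R_CompleteNormedModule) f (IZR q) 0 0 1) as H.
replace (IZR q * 0 + 0) with 0 in H by ring.
replace (IZR q * 1 + 0) with (0 + IZR q * 1) in H by ring.
specialize (H (ex_RInt_cont f _ _ Hf)).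
rewrite (quasi_periodic_Z (RInt f 0) 1 (RInt f 0 1)) in H
  by (intros; apply RInt_quasi_periodic; assumption).
rewrite RInt_point in H.
rewrite (RInt_scal (V := R_CompleteNormedModule)) in H.
2:{ apply ex_RInt_cont; intros x.
    apply (continuous_comp (fun y => IZR q * y + 0) f); [|apply Hf].
    apply continuous_of_derivable; auto_derive; exact I. }
change (IZR q * RInt (fun y => f (IZR q * y + 0)) 0 1
        = 0 + IZR q * RInt f 0 1) in H.
rewrite Rplus_0_l in H; apply Rmult_eq_reg_l in H; [|lra].
rewrite <- H; apply RInt_ext; intros x _; rewrite Rplus_0_r; reflexivity.
Qed.

(** * Bessel's inequality *)

(** Continuity is localized because the quotient to which Bessel's inequality
    is applied is singular outside the interval of integration. *)
Definition continuous_on (u v : R) (f : R -> R) : Prop :=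
  forall x, u <= x <= v -> continuous f x.

Lemma ex_RInt_on (u v : R) (f : R -> R) :
  u <= v -> continuous_on u v f -> ex_RInt f u v.
Proof.
intros Huv H; apply (ex_RInt_continuous (V := R_CompleteNormedModule)).
rewrite Rmin_left, Rmax_right by assumption; exact H.
Qed.

Lemma continuous_on_mult (u v : R) (f g : R -> R) :
  continuous_on u v f -> continuous_on u v g ->
  continuous_on u v (fun x => f x * g x).
Proof. intros Hf Hg x Hx; apply (continuous_mult f g); auto. Qed.

Lemma continuous_on_lin (u v c : R) (f g : R -> R) :
  continuous_on u v f -> continuous_on u v g ->
  continuous_on u v (fun x => f x + c * g x).
Proof.
intros Hf Hg x Hx.
apply (continuous_plus f (fun x => c * g x)); [auto|].
apply (continuous_mult (fun _ => c) g); [apply continuous_const | auto].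
Qed.

Lemma RInt_lin (u v c : R) (f g : R -> R) :
  ex_RInt f u v -> ex_RInt g u v ->
  RInt (fun x => f x + c * g x) u v = RInt f u v + c * RInt g u v :> R.
Proof.
intros Hf Hg.
apply is_RInt_unique.
apply (is_RInt_plus (V := R_NormedModule) f (fun x => c * g x)).
- apply (RInt_correct (V := R_CompleteNormedModule)); assumption.
- apply (is_RInt_scal (V := R_NormedModule) g).
  apply (RInt_correct (V := R_CompleteNormedModule)); assumption.
Qed.

Lemma sum_n_nonneg_bounded_lim_0 (b : nat -> R) (B : R) :
  (forall n, 0 <= b n) -> (forall n, sum_n b n <= B) -> is_lim_seq b 0.
Proof.
intros H0 HB; apply ex_series_lim_0.
destruct (ex_finite_lim_seq_incr (sum_n b) B) as [l Hl]; [|assumption|].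
- intros n; rewrite sum_Sn; change (sum_n b n <= sum_n b n + b (S n)).
  specialize (H0 (S n)); lra.
- exists l; exact Hl.
Qed.

Section Bessel.

Variables (u v c : R) (e : nat -> R -> R) (k : R -> R).
Hypotheses (Huv : u <= v) (Hc : 0 < c)
  (He : forall n, continuous_on u v (e n))
  (Hk : continuous_on u v k)
  (Horth : forall i j, i <> j -> RInt (fun x => e i x * e j x) u v = 0)
  (Hnorm : forall i, RInt (fun x => e i x * e i x) u v = c).

Let coeff (n : nat) : R := RInt (fun x => k x * e n x) u v.

(** [k] minus its orthogonal projection on the first [n] modes. *)
Fixpoint residual (n : nat) (x : R) : R :=
  match n with
  | O => k x
  | S n => residual n x + (- (coeff n / c)) * e n x
  end.

Lemma residual_continuous (n : nat) : continuous_on u v (residual n).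
Proof.
induction n as [|n IH]; [exact Hk|].
apply continuous_on_lin; auto.
Qed.

Lemma residual_coeff (n j : nat) : (n <= j)%nat ->
  RInt (fun x => residual n x * e j x) u v = coeff j :> R.
Proof.
induction n as [|n IH]; intros Hj; [reflexivity|].
rewrite (RInt_eq _ (fun x => residual n x * e j x
                       + (- (coeff n / c)) * (e n x * e j x)))
  by (intros; simpl; ring).
rewrite RInt_lin, IH, Horth by
  first [lia | apply ex_RInt_on;
         auto using continuous_on_mult, residual_continuous].
ring.
Qed.

(** Pythagoras: removing the component along [e n], whose squared norm is [c],
    lowers the energy by [coeff n ^ 2 / c]. *)
Lemma residual_energy (n : nat) :
  RInt (fun x => residual (S n) x * residual (S n) x) u v
  = RInt (fun x => residual n x * residual n x) u v - coeff n * coeff n / c :> R.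
Proof.
assert (Hr := residual_continuous n).
assert (X1 : ex_RInt (fun x => residual n x * residual n x) u v)
  by (apply ex_RInt_on; auto using continuous_on_mult).
assert (X2 : ex_RInt (fun x => residual n x * e n x) u v)
  by (apply ex_RInt_on; auto using continuous_on_mult).
assert (X3 : ex_RInt (fun x => e n x * e n x) u v)
  by (apply ex_RInt_on; auto using continuous_on_mult).
set (d := coeff n / c).
rewrite (RInt_eq _ (fun x => (residual n x * residual n x
    + (- 2 * d) * (residual n x * e n x)) + (d * d) * (e n x * e n x)))
  by (intros; simpl; fold d; ring).
rewrite RInt_lin; [rewrite RInt_lin | |]; try assumption.
- rewrite residual_coeff, Hnorm by lia; unfold d; field; lra.
- apply ex_RInt_on; auto using continuous_on_lin, continuous_on_mult.
Qed.

Lemma bessel_inequality (n : nat) :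
  sum_n (fun j => coeff j * coeff j) n <= c * RInt (fun x => k x * k x) u v.
Proof.
assert (E : sum_n (fun j => coeff j * coeff j) n
  = c * (RInt (fun x => k x * k x) u v
         - RInt (fun x => residual (S n) x * residual (S n) x) u v) :> R).
{ induction n as [|n IH].
  - rewrite sum_O, residual_energy; simpl residual; field; lra.
  - rewrite sum_Sn, IH, (residual_energy (S n)).
    change plus with Rplus; field; lra. }
assert (0 <= RInt (fun x => residual (S n) x * residual (S n) x) u v).
{ apply RInt_ge_0; [assumption| |intros; nra].
  assert (Hr := residual_continuous (S n)).
  apply ex_RInt_on; auto using continuous_on_mult. }
rewrite E; nra.
Qed.

Lemma orthogonal_coeff_lim_0 : is_lim_seq coeff 0.
Proof.
apply is_lim_seq_abs_0.
apply (is_lim_seq_ext (fun n => sqrt (coeff n * coeff n))).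
{ intros n; rewrite <- sqrt_Rsqr_abs; reflexivity. }
rewrite <- sqrt_0.
apply (is_lim_seq_continuous sqrt (fun n => coeff n * coeff n)).
- apply continuity_pt_filterlim, continuous_sqrt.
- apply (sum_n_nonneg_bounded_lim_0 _ (c * RInt (fun x => k x * k x) u v)).
  + intros; nra.
  + apply bessel_inequality.
Qed.

End Bessel.

(** * The increment of a function divided by [2 sin(pi s)] *)

Definition slope (f : R -> R) (x s : R) : R :=
  if Req_EM_T s 0 then Derive f x else (f (x + s) - f x) / s.

Lemma slope_mult (f : R -> R) (x s : R) : slope f x s * s = f (x + s) - f x.
Proof.
unfold slope; destruct (Req_EM_T s 0) as [->|Hs].
- rewrite Rplus_0_r; ring.
- field; assumption.
Qed.

Lemma slope_continuous (f : R -> R) (x s : R) :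
  (forall y, ex_derive f y) -> continuous (slope f x) s.
Proof.
intros Hf; destruct (Req_dec s 0) as [->|Hs].
- apply continuity_pt_filterlim; intros eps Heps.
  pose proof (Derive_correct f x (Hf x)) as Hd.
  apply is_derive_Reals in Hd.
  destruct (Hd eps Heps) as [delta Hdelta].
  exists delta; split; [apply cond_pos|]; intros h [[_ Hh0] Hh].
  simpl in Hh |- *; unfold R_dist in *.
  rewrite Rminus_0_r in Hh; unfold slope.
  destruct (Req_EM_T h 0) as [->|_]; [lra|].
  destruct (Req_EM_T 0 0) as [_|?]; [|lra].
  apply Hdelta; auto.
- apply (continuous_ext_loc _ (fun h => (f (x + h) - f x) / h)).
  + assert (Hp : 0 < Rabs s) by (apply Rabs_pos_lt; assumption).
    exists (mkposreal _ Hp); intros h Hh; unfold slope.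
    destruct (Req_EM_T h 0) as [->|_]; [|reflexivity].
    change (Rabs (0 - s) < Rabs s) in Hh.
    rewrite Rminus_0_l, Rabs_Ropp in Hh; lra.
  + apply continuous_of_derivable; auto_derive; auto.
Qed.

Lemma sin_Z_PI (j : Z) : sin (IZR j * PI) = 0.
Proof. apply sin_eq_0_1; exists j; reflexivity. Qed.

Lemma cos_phase_continuous (c phi s : R) :
  continuous (fun t => cos (c * t + phi)) s.
Proof. apply continuous_of_derivable; auto_derive; exact I. Qed.

Lemma RInt_cos_period (phi : R) (j : Z) : j <> 0%Z ->
  RInt (fun s => cos (2 * PI * IZR j * s + phi)) (- (1 / 2)) (1 / 2) = 0 :> R.
Proof.
intros Hj; apply not_0_IZR in Hj; assert (Hpi := PI_RGT_0).
set (c := 2 * PI * IZR j).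
assert (Hc : c <> 0) by (unfold c; apply Rmult_integral_contrapositive; lra).
apply is_RInt_unique.
replace 0 with (minus (sin (c * (1 / 2) + phi) / c)
                      (sin (c * (- (1 / 2)) + phi) / c)).
- apply (is_RInt_derive (V := R_CompleteNormedModule)
    (fun s => sin (c * s + phi) / c)).
  + intros s _; auto_derive; [exact I | field; assumption].
  + intros s _; apply cos_phase_continuous.
- unfold c.
  replace (2 * PI * IZR j * (1 / 2)) with (IZR j * PI) by field.
  replace (2 * PI * IZR j * (- (1 / 2))) with (- (IZR j * PI)) by field.
  rewrite !sin_plus, cos_neg, sin_neg, sin_Z_PI.
  change (minus ?y ?z) with (y - z); in_R; field; lra.
Qed.

(** The phase [phi] treats sines ([phi = 0]) and cosines ([phi = PI / 2]) at
    once, and so the real and the imaginary parts of a Fourier series. *)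
Definition odd_mode (phi : R) (n : nat) (s : R) : R :=
  sin ((2 * INR n + 1) * (PI * s) + phi).

Lemma odd_mode_continuous (phi : R) (n : nat) (s : R) :
  continuous (odd_mode phi n) s.
Proof. apply continuous_of_derivable; unfold odd_mode; auto_derive; exact I. Qed.

Lemma odd_mode_mult (phi : R) (i j : nat) (s : R) :
  odd_mode phi i s * odd_mode phi j s
  = / 2 * cos (2 * PI * IZR (Z.of_nat i - Z.of_nat j) * s + 0)
    + - / 2 * cos (2 * PI * IZR (Z.of_nat i + Z.of_nat j + 1) * s + 2 * phi).
Proof.
unfold odd_mode; rewrite !plus_IZR, minus_IZR, <- !INR_IZR_INZ.
set (A := (2 * INR i + 1) * (PI * s) + phi).
set (B := (2 * INR j + 1) * (PI * s) + phi).
replace (2 * PI * (INR i - INR j) * s + 0) with (A - B) by (unfold A, B; ring).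
replace (2 * PI * (INR i + INR j + 1) * s + 2 * phi) with (A + B)
  by (unfold A, B; ring).
rewrite cos_minus, cos_plus; field.
Qed.

Lemma odd_mode_orthogonal (phi : R) (i j : nat) :
  RInt (fun s => odd_mode phi i s * odd_mode phi j s) (- (1 / 2)) (1 / 2)
  = (if Nat.eq_dec i j then / 2 else 0) :> R.
Proof.
rewrite (RInt_eq _ _ _ _ (odd_mode_mult phi i j)).
rewrite RInt_lin; [| |apply ex_RInt_cont, cos_phase_continuous].
2:{ apply ex_RInt_cont; intros s.
    apply (continuous_mult (fun _ => / 2));
      [apply continuous_const | apply cos_phase_continuous]. }
rewrite (RInt_cos_period _ (Z.of_nat i + Z.of_nat j + 1)) by lia.
rewrite Rmult_0_r, Rplus_0_r.
destruct (Nat.eq_dec i j) as [->|Hij].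
- rewrite (RInt_eq _ (fun _ => / 2)).
  + rewrite RInt_const; change scal with Rmult; simpl; in_R; field.
  + intros s; rewrite Z.sub_diag.
    replace (2 * PI * 0 * s + 0) with 0 by ring; rewrite cos_0; ring.
- rewrite (RInt_scal (V := R_CompleteNormedModule) _ _ _ (/ 2))
    by (apply ex_RInt_cont, cos_phase_continuous).
  rewrite RInt_cos_period by lia; apply Rmult_0_r.
Qed.

Lemma odd_mode_coeff_lim_0 (phi : R) (k : R -> R) :
  continuous_on (- (1 / 2)) (1 / 2) k ->
  is_lim_seq
    (fun n => RInt (fun s => k s * odd_mode phi n s) (- (1 / 2)) (1 / 2)) 0.
Proof.
intros Hk; apply (orthogonal_coeff_lim_0 _ _ (/ 2)); try lra; try exact Hk.
- intros n s _; apply odd_mode_continuous.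
- intros i j Hij; rewrite odd_mode_orthogonal.
  destruct (Nat.eq_dec i j); [contradiction | reflexivity].
- intros i; rewrite odd_mode_orthogonal.
  destruct (Nat.eq_dec i i); [reflexivity | contradiction].
Qed.

Definition twice_sin (s : R) : R := 2 * sin (PI * s).

(** The increment [f (x + s) - f x] over [2 sin(pi s)].  Dividing numerator and
    denominator by [s] first removes the singularity at [s = 0] by the same
    construction [slope] on both sides, which makes continuity immediate. *)
Definition dirichlet_quotient (f : R -> R) (x s : R) : R :=
  slope f x s / slope twice_sin 0 s.

(** Within the interval, [sin(pi s)] vanishes only at [0], where the slope is
    the derivative [2 pi]. *)
Lemma slope_twice_sin_neq_0 (s : R) :
  - (1 / 2) <= s <= 1 / 2 -> slope twice_sin 0 s <> 0.
Proof.
intros Hs; assert (Hpi := PI_RGT_0); unfold slope.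
destruct (Req_EM_T s 0) as [_|Hs0].
- rewrite (is_derive_unique twice_sin 0 (2 * PI)); [lra|].
  unfold twice_sin; auto_derive; [exact I|].
  rewrite Rmult_0_r, cos_0; ring.
- unfold twice_sin; rewrite Rplus_0_l, Rmult_0_r, sin_0.
  intros E.
  assert (E' : sin (PI * s) = 0).
  { replace (sin (PI * s)) with ((2 * sin (PI * s) - 2 * 0) / s * (s / 2))
      by (field; assumption).
    rewrite E; ring. }
  destruct (sin_eq_0_0 _ E') as [j Hj].
  assert (Ej : s = IZR j) by (apply (Rmult_eq_reg_l PI); lra).
  assert (j = 0%Z).
  { assert (-1 < j)%Z by (apply lt_IZR; lra).
    assert (j < 1)%Z by (apply lt_IZR; lra). lia. }
  subst j; contradiction.
Qed.

Lemma dirichlet_quotient_continuous (f : R -> R) (x : R) :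
  (forall y, ex_derive f y) ->
  continuous_on (- (1 / 2)) (1 / 2) (dirichlet_quotient f x).
Proof.
intros Hf s Hs.
apply (continuous_mult (slope f x) (fun s => / slope twice_sin 0 s)).
- apply slope_continuous; assumption.
- apply (continuous_comp (slope twice_sin 0) Rinv).
  + apply slope_continuous; intros y; unfold twice_sin; auto_derive; exact I.
  + apply continuous_Rinv, slope_twice_sin_neq_0; assumption.
Qed.

Lemma dirichlet_quotient_mult (f : R -> R) (x s : R) :
  - (1 / 2) <= s <= 1 / 2 ->
  dirichlet_quotient f x s * (2 * sin (PI * s)) = f (x + s) - f x.
Proof.
intros Hs.
pose proof (slope_mult twice_sin 0 s) as E.
pose proof (slope_twice_sin_neq_0 s Hs) as H0.
pose proof (slope_mult f x s) as Ef.
unfold twice_sin at 2 3 in E.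
rewrite Rplus_0_l, Rmult_0_r, sin_0, Rmult_0_r, Rminus_0_r in E.
rewrite <- E, <- Ef; unfold dirichlet_quotient; field; assumption.
Qed.

Section FourierPoint.

Variables (f : R -> R) (x : R).
Hypotheses (Hd : forall y, ex_derive f y) (H1 : periodic1 f).

Definition dirichlet_coeff (phi : R) (n : nat) : R :=
  RInt (fun s => dirichlet_quotient f x s * odd_mode phi n s)
    (- (1 / 2)) (1 / 2).

Lemma translate_continuous (s : R) : continuous (fun s => f (x + s)) s.
Proof. apply continuous_of_derivable; auto_derive; auto. Qed.

(** The constant [f x] may be subtracted from [f (x + s)] because a nonzero
    frequency integrates to zero; the increment is then [2 sin(pi s)] times the
    quotient, and the product formula for [sin] and [cos] gives the two
    neighbouring odd modes. *)
Lemma fourier_term_telescopes (phi : R) (n : nat) :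
  RInt (fun s => f (x + s) * cos (2 * PI * IZR (Z.of_nat (S n)) * s + phi))
    (- (1 / 2)) (1 / 2)
  = dirichlet_coeff phi (S n) - dirichlet_coeff phi n :> R.
Proof.
assert (Hk := dirichlet_quotient_continuous f x Hd).
assert (X : forall i, ex_RInt (fun s => dirichlet_quotient f x s
    * odd_mode phi i s) (- (1 / 2)) (1 / 2)).
{ intros i; apply ex_RInt_on; [lra|]; apply continuous_on_mult; [exact Hk|].
  intros s _; apply odd_mode_continuous. }
set (j := Z.of_nat (S n)).
transitivity (RInt (fun s => f (x + s) * cos (2 * PI * IZR j * s + phi)
    + (- f x) * cos (2 * PI * IZR j * s + phi)) (- (1 / 2)) (1 / 2)).
{ rewrite RInt_lin.
  - rewrite RInt_cos_period by (unfold j; lia).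
    rewrite Rmult_0_r, Rplus_0_r; reflexivity.
  - apply ex_RInt_cont; intros s; apply (continuous_mult (fun s => f (x + s)));
      [apply translate_continuous | apply cos_phase_continuous].
  - apply ex_RInt_cont, cos_phase_continuous. }
transitivity (RInt (fun s => dirichlet_quotient f x s * odd_mode phi (S n) s
    + -1 * (dirichlet_quotient f x s * odd_mode phi n s)) (- (1 / 2)) (1 / 2)).
- apply RInt_ext; intros s Hs.
  rewrite Rmin_left, Rmax_right in Hs by lra.
  pose proof (dirichlet_quotient_mult f x s ltac:(lra)) as E.
  in_R; transitivity ((f (x + s) - f x) * cos (2 * PI * IZR j * s + phi)); [ring|].
  rewrite <- E; unfold odd_mode, j; rewrite <- INR_IZR_INZ, S_INR.
  set (A := 2 * PI * (INR n + 1) * s + phi).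
  replace ((2 * (INR n + 1) + 1) * (PI * s) + phi)
    with (A + PI * s) by (unfold A; ring).
  replace ((2 * INR n + 1) * (PI * s) + phi)
    with (A - PI * s) by (unfold A; ring).
  rewrite sin_plus, sin_minus.
  in_R; ring.
- rewrite RInt_lin by apply X; unfold dirichlet_coeff; ring.
Qed.

(** The first odd mode is [sin(pi s)], so the division by [2 sin(pi s)] is
    undone.  This is where the value of the Fourier series comes from. *)
Lemma dirichlet_coeff_0 : 2 * dirichlet_coeff 0 0 = RInt f 0 1 - f x :> R.
Proof.
assert (Hc : forall y, continuous f y)
  by (intros; apply continuous_of_derivable, Hd).
assert (Hk := dirichlet_quotient_continuous f x Hd).
assert (E : RInt (fun s => f (x + s)) (- (1 / 2)) (1 / 2) = RInt f 0 1 :> R).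
{ rewrite <- (RInt_period f 1 (- (1 / 2) + x) Hc H1).
  replace (- (1 / 2) + x + 1) with (1 / 2 + x) by field.
  rewrite <- RInt_shift by assumption.
  apply RInt_eq; intros s; rewrite Rplus_comm; reflexivity. }
rewrite <- E; unfold dirichlet_coeff.
transitivity (RInt (fun s => f (x + s) + (- f x) * 1) (- (1 / 2)) (1 / 2)).
- rewrite (RInt_ext (fun s => f (x + s) + (- f x) * 1)
      (fun s => 2 * (dirichlet_quotient f x s * odd_mode 0 0 s))).
  + symmetry; apply (RInt_scal (V := R_CompleteNormedModule)).
    apply ex_RInt_on; [lra|]; apply continuous_on_mult; [exact Hk|].
    intros s _; apply odd_mode_continuous.
  + intros s Hs; rewrite Rmin_left, Rmax_right in Hs by lra.
    pose proof (dirichlet_quotient_mult f x s ltac:(lra)) as E'.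
    unfold odd_mode; simpl INR.
    replace ((2 * 0 + 1) * (PI * s) + 0) with (PI * s) by ring.
    in_R; lra.
- rewrite RInt_lin.
  + rewrite RInt_const; change scal with Rmult; simpl; in_R; field.
  + apply ex_RInt_cont, translate_continuous.
  + apply ex_RInt_cont; intros; apply continuous_const.
Qed.

End FourierPoint.

(** * Convergence of Fourier series *)

Lemma CInt_pair (f g : R -> R) (a b : R) :
  (forall x, continuous f x) -> (forall x, continuous g x) ->
  CInt (fun x => (f x, g x)) a b = (RInt f a b, RInt g a b).
Proof.
intros Hf Hg; unfold CInt.
apply (is_RInt_unique (V := C_R_CompleteNormedModule)).
apply (is_RInt_fct_extend_pair (U := R_NormedModule) (V := R_NormedModule)
  (fun x => (f x, g x))).
- apply (RInt_correct (V := R_CompleteNormedModule)), ex_RInt_cont; assumption.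
- apply (RInt_correct (V := R_CompleteNormedModule)), ex_RInt_cont; assumption.
Qed.

(** Real part ([phi = 0]) and imaginary part ([phi = PI / 2]) of a Fourier
    coefficient; see [fourier_coeff_cos]. *)
Definition cos_coeff (f : R -> R) (phi : R) (m : Z) : R :=
  RInt (fun x => f x * cos (2 * PI * IZR m * x + phi)) 0 1.

Lemma mult_cos_continuous (f : R -> R) (c phi x : R) :
  (forall x, continuous f x) ->
  continuous (fun t => f t * cos (c * t + phi)) x.
Proof.
intros Hf; apply (continuous_mult f); [apply Hf | apply cos_phase_continuous].
Qed.

Lemma cos_add_half_PI (t : R) : cos (t + PI / 2) = - sin t.
Proof. rewrite cos_plus, cos_PI2, sin_PI2; ring. Qed.

Lemma fourier_coeff_cos (f : R -> R) (m : Z) :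
  (forall x, continuous f x) ->
  fourier_coeff f m = (cos_coeff f 0 m, cos_coeff f (PI / 2) m).
Proof.
intros Hf; unfold cos_coeff.
rewrite <- CInt_pair by (intros; apply mult_cos_continuous, Hf).
unfold fourier_coeff, CInt.
apply (RInt_ext (V := C_R_CompleteNormedModule)); intros x _.
rewrite cos_add_half_PI, Rplus_0_r; unfold cis; rewrite cos_neg, sin_neg.
unfold Cmult, RtoC; simpl; apply f_equal2; in_R; ring.
Qed.

Lemma RInt_translate (f : R -> R) (x c phi : R) (m : Z) :
  (forall y, continuous f y) -> periodic1 f ->
  RInt (fun t => f t * cos (2 * PI * IZR m * (t - x) + phi)) 0 1
  = RInt (fun s => f (x + s) * cos (2 * PI * IZR m * s + phi))
      (- (1 / 2)) (1 / 2) :> R.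
Proof.
intros Hf H1.
set (h := fun t => f t * cos (2 * PI * IZR m * (t - x) + phi)).
assert (Hh : forall t, continuous h t).
{ intros t; apply (continuous_mult f); [apply Hf|].
  apply continuous_of_derivable; auto_derive; exact I. }
assert (H1h : forall t, h (t + 1) = h t).
{ intros t; unfold h; rewrite H1; f_equal.
  replace (2 * PI * IZR m * (t + 1 - x) + phi)
    with (2 * PI * IZR m * (t - x) + phi + IZR m * (2 * PI)) by ring.
  apply periodic_Z; intros y; rewrite cos_plus, cos_2PI, sin_2PI; ring. }
rewrite <- (RInt_period h 1 (- (1 / 2) + x) Hh H1h).
replace (- (1 / 2) + x + 1) with (1 / 2 + x) by field.
rewrite <- RInt_shift by assumption.
apply RInt_eq; intros s; unfold h.
replace (s + x - x) with s by ring; rewrite (Rplus_comm s x); reflexivity.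
Qed.

(** The product with [cis (2 pi m x)] is a coefficient of the translate
    [f (x + .)], and by periodicity the integral may be taken over
    the period centred at [0]. *)
Lemma fourier_term (f : R -> R) (x : R) (m : Z) :
  (forall y, continuous f y) -> periodic1 f ->
  (fourier_coeff f m * cis (2 * PI * IZR m * x))%C
  = (RInt (fun s => f (x + s) * cos (2 * PI * IZR m * s + 0))
       (- (1 / 2)) (1 / 2),
     RInt (fun s => f (x + s) * cos (2 * PI * IZR m * s + PI / 2))
       (- (1 / 2)) (1 / 2)).
Proof.
intros Hf H1; rewrite fourier_coeff_cos by assumption.
rewrite <- !RInt_translate by assumption.
set (X := 2 * PI * IZR m * x).
assert (L : forall a b, a * cos_coeff f 0 m + b * cos_coeff f (PI / 2) m
  = RInt (fun t => a * (f t * cos (2 * PI * IZR m * t + 0))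
                   + b * (f t * cos (2 * PI * IZR m * t + PI / 2))) 0 1 :> R).
{ intros a b; rewrite RInt_lin.
  - rewrite (RInt_scal (V := R_CompleteNormedModule)); [reflexivity|].
    apply ex_RInt_cont; intros; apply mult_cos_continuous, Hf.
  - apply (ex_RInt_scal (V := R_NormedModule)), ex_RInt_cont.
    intros; apply mult_cos_continuous, Hf.
  - apply ex_RInt_cont; intros; apply mult_cos_continuous, Hf. }
unfold Cmult, cis; simpl; f_equal.
- transitivity (cos X * cos_coeff f 0 m + - sin X * cos_coeff f (PI / 2) m);
    [ring|].
  rewrite L; apply RInt_eq; intros t.
  replace (2 * PI * IZR m * (t - x) + 0) with (2 * PI * IZR m * t - X)
    by (unfold X; ring).
  rewrite cos_add_half_PI, Rplus_0_r, cos_minus; ring.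
- transitivity (sin X * cos_coeff f 0 m + cos X * cos_coeff f (PI / 2) m);
    [ring|].
  rewrite L; apply RInt_eq; intros t.
  replace (2 * PI * IZR m * (t - x) + PI / 2)
    with (2 * PI * IZR m * t - X + PI / 2) by (unfold X; ring).
  rewrite !cos_add_half_PI, Rplus_0_r, sin_minus; ring.
Qed.

Lemma is_series_telescoping (b : nat -> C) (u v : nat -> R) :
  (forall k, b k = (u (S k) - u k, v (S k) - v k)) ->
  is_lim_seq u 0 -> is_lim_seq v 0 ->
  is_series (V := C_R_NormedModule) b (- u 0%nat, - v 0%nat).
Proof.
intros Hb Hu Hv.
assert (E : forall n, sum_n (G := C_R_NormedModule) b n
  = (u (S n) - u 0%nat, v (S n) - v 0%nat)).
{ induction n as [|n IH].
  - rewrite sum_O; apply Hb.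
  - rewrite sum_Sn, IH, Hb; change plus with Cplus; unfold Cplus; simpl.
    f_equal; ring. }
apply filterlim_locally; intros eps.
apply is_lim_seq_spec in Hu; apply is_lim_seq_spec in Hv.
destruct (Hu eps) as [N1 HN1]; destruct (Hv eps) as [N2 HN2].
exists (max N1 N2); intros n Hn; rewrite E.
specialize (HN1 (S n) ltac:(lia)); specialize (HN2 (S n) ltac:(lia)).
split.
- change (Rabs (u (S n) - u 0%nat - - u 0%nat) < eps).
  replace (u (S n) - u 0%nat - - u 0%nat) with (u (S n) - 0) by ring; exact HN1.
- change (Rabs (v (S n) - v 0%nat - - v 0%nat) < eps).
  replace (v (S n) - v 0%nat - - v 0%nat) with (v (S n) - 0) by ring; exact HN2.
Qed.

Lemma is_series_Znz_unique (b : Z -> C) (l l' : C) :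
  is_series_Znz b l -> is_series_Znz b l' -> l' = l.
Proof.
intros [lp [ln [Hp [Hn ->]]]] [lp' [ln' [Hp' [Hn' ->]]]].
f_equal; [revert Hp Hp' | revert Hn Hn'];
  intros A B; symmetry;
  exact (filterlim_locally_unique (V := C_R_NormedModule) _ _ _ A B).
Qed.

Lemma Series_Znz_unique (b : Z -> C) (l : C) :
  is_series_Znz b l -> Series_Znz b = l.
Proof.
intros H; apply (iota_unique (V := C_R_CompleteNormedModule)); [|exact H].
intros y Hy; exact (is_series_Znz_unique b l y H Hy).
Qed.

(** The positive and the negative frequencies telescope to minus the zeroth
    coefficients of the quotient.  Changing the sign of the frequency amounts
    to changing the sign of the phase, so in the sum of the two halves the real
    parts agree and double, whereas the imaginary parts cancel. *)
Theorem fourier_series_converges (f : R -> R) (x : R) :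
  (forall y, ex_derive f y) -> periodic1 f ->
  is_series_Znz (fun m => fourier_coeff f m * cis (2 * PI * IZR m * x))%C
    (RtoC (f x - RInt f 0 1)).
Proof.
intros Hd H1.
assert (Hc : forall y, continuous f y)
  by (intros; apply continuous_of_derivable, Hd).
assert (Hk := dirichlet_quotient_continuous f x Hd).
set (D := dirichlet_coeff f x).
assert (lim : forall phi, is_lim_seq (D phi) 0)
  by (intros; apply odd_mode_coeff_lim_0, Hk).
exists (- D 0 0%nat, - D (PI / 2) 0%nat), (- D 0 0%nat, - D (- (PI / 2)) 0%nat).
split; [|split].
- apply is_series_telescoping; [|apply lim|apply lim].
  intros k; rewrite fourier_term by assumption.
  f_equal; apply fourier_term_telescopes; assumption.
- apply is_series_telescoping; [|apply lim|apply lim].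
  intros k; rewrite fourier_term by assumption.
  f_equal; unfold D; rewrite <- fourier_term_telescopes by assumption;
    apply RInt_eq; intros s; f_equal; rewrite opp_IZR, <- cos_neg;
    f_equal; ring.
- pose proof (dirichlet_coeff_0 f x Hd H1) as E; fold D in E.
  assert (E' : D (- (PI / 2)) 0%nat = - 1 * D (PI / 2) 0%nat).
  { unfold D, dirichlet_coeff; symmetry.
    rewrite <- (RInt_scal (V := R_CompleteNormedModule)).
    - apply RInt_eq; intros s; change scal with Rmult; unfold odd_mode.
      rewrite !sin_plus, cos_neg, sin_neg, cos_PI2, sin_PI2.
      simpl; ring.
    - apply ex_RInt_on; [lra|]; apply continuous_on_mult; [exact Hk|].
      intros s _; apply odd_mode_continuous. }
  unfold RtoC, Cplus; simpl; f_equal; [lra|rewrite E'; ring].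
Qed.

(** * Averages along a rational rotation *)

Fixpoint sum_lt (h : nat -> R) (n : nat) : R :=
  match n with O => 0 | S n => sum_lt h n + h n end.

Definition birkhoff_sum (f : R -> R) (alpha : R) (n : nat) (x : R) : R :=
  sum_lt (fun j => f (x + INR j * alpha)) n.

Definition orbit_average (f : R -> R) (alpha : R) (n : nat) (x : R) : R :=
  birkhoff_sum f alpha n x / INR n.

(** The average of the Birkhoff sums of lengths [0, ..., n - 1], the classical
    solution of the cohomological equation [transfer_cohomological]. *)
Definition transfer (f : R -> R) (alpha : R) (n : nat) (x : R) : R :=
  sum_lt (fun j => birkhoff_sum f alpha j x) n / INR n.

Lemma birkhoff_sum_shift (f : R -> R) (alpha : R) (n : nat) (x : R) :
  birkhoff_sum f alpha n (x + alpha)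
  = birkhoff_sum f alpha n x + (f (x + INR n * alpha) - f x).
Proof.
unfold birkhoff_sum; induction n as [|n IH]; simpl sum_lt.
- simpl; rewrite Rmult_0_l, Rplus_0_r; ring.
- rewrite IH, S_INR.
  replace (x + alpha + INR n * alpha) with (x + (INR n + 1) * alpha) by ring.
  ring.
Qed.

(** By [birkhoff_sum_shift] the shift changes the Birkhoff sum of length [j] by
    [f (x + j alpha) - f x]; averaging these changes over [j < n] gives the
    claim. *)
Lemma transfer_cohomological (f : R -> R) (alpha : R) (n : nat) (x : R) :
  (0 < n)%nat ->
  transfer f alpha n (x + alpha) - transfer f alpha n x
  = orbit_average f alpha n x - f x.
Proof.
intros Hn; apply lt_0_INR in Hn; unfold transfer, orbit_average.
assert (E : forall k,
  sum_lt (fun j => birkhoff_sum f alpha j (x + alpha)) k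
  = sum_lt (fun j => birkhoff_sum f alpha j x) k
    + (birkhoff_sum f alpha k x - INR k * f x)).
{ induction k as [|k IH].
  - unfold birkhoff_sum; simpl; ring.
  - cbn [sum_lt]; rewrite IH, birkhoff_sum_shift, S_INR.
    unfold birkhoff_sum; cbn [sum_lt]; ring. }
rewrite E; field; lra.
Qed.

Lemma orbit_average_shift (f : R -> R) (alpha : R) (n : nat) :
  (forall x, f (x + INR n * alpha) = f x) ->
  forall x, orbit_average f alpha n (x + alpha) = orbit_average f alpha n x.
Proof.
intros H x; unfold orbit_average; rewrite birkhoff_sum_shift, H; f_equal; ring.
Qed.

Lemma sum_lt_ext (h h' : nat -> R) (n : nat) :
  (forall j, h j = h' j) -> sum_lt h n = sum_lt h' n.
Proof.
intros H; induction n as [|n IH]; simpl; [reflexivity | now rewrite IH, H].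
Qed.

Lemma orbit_average_periodic1 (f : R -> R) (alpha : R) (n : nat) :
  periodic1 f -> periodic1 (orbit_average f alpha n).
Proof.
intros H x; unfold orbit_average, birkhoff_sum; f_equal.
apply sum_lt_ext; intros j.
rewrite <- (H (x + INR j * alpha)); f_equal; ring.
Qed.

Lemma birkhoff_sum_derivable (f : R -> R) (alpha : R) (n : nat) (x : R) :
  (forall y, ex_derive f y) -> ex_derive (birkhoff_sum f alpha n) x.
Proof.
intros H; unfold birkhoff_sum; induction n as [|n IH]; simpl.
- apply ex_derive_const.
- apply (ex_derive_plus (V := R_NormedModule)); [exact IH|auto_derive; auto].
Qed.

Lemma orbit_average_derivable (f : R -> R) (alpha : R) (n : nat) (x : R) :
  (forall y, ex_derive f y) -> ex_derive (orbit_average f alpha n) x.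
Proof.
intros H; unfold orbit_average, Rdiv.
apply (ex_derive_mult (birkhoff_sum f alpha n) (fun _ => / INR n));
  [apply birkhoff_sum_derivable, H | apply ex_derive_const].
Qed.

Lemma add_orbit_average_ge (f : R -> R) (alpha a c : R) (n : nat) (x : R) :
  (0 < n)%nat -> (forall y, c <= a + f y) ->
  c <= a + orbit_average f alpha n x.
Proof.
intros Hn Hc; apply lt_0_INR in Hn.
enough (c - a <= orbit_average f alpha n x) by lra; unfold orbit_average.
apply (Rmult_le_reg_r (INR n)); [assumption|].
unfold Rdiv; rewrite Rmult_assoc, Rinv_l, Rmult_1_r by lra.
clear Hn; unfold birkhoff_sum; induction n as [|n IH].
- simpl; lra.
- rewrite S_INR; cbn [sum_lt]; specialize (Hc (x + INR n * alpha)); lra.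
Qed.

Lemma cos_periodic_Z (k : Z) (t : R) : cos (t + IZR k * (2 * PI)) = cos t.
Proof.
apply (periodic_Z cos); intros y; rewrite cos_plus, cos_2PI, sin_2PI; ring.
Qed.

(** A frequency [l] with [l alpha] an integer is invariant under the rotation,
    so every translate of [f] by a multiple of [alpha] has the same coefficient
    at [l]. *)
Lemma cos_coeff_orbit_average (f : R -> R) (alpha phi : R) (n : nat) (l k : Z) :
  (0 < n)%nat -> (forall y, ex_derive f y) -> periodic1 f ->
  IZR l * alpha = IZR k ->
  cos_coeff (orbit_average f alpha n) phi l = cos_coeff f phi l.
Proof.
intros Hn Hd H1 Hl; apply lt_0_INR in Hn.
assert (Hc : forall y, continuous f y)
  by (intros; apply continuous_of_derivable, Hd).
assert (Hcb : forall i y, continuous (birkhoff_sum f alpha i) y)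
  by (intros; apply continuous_of_derivable, birkhoff_sum_derivable, Hd).
assert (E : forall i, cos_coeff (birkhoff_sum f alpha i) phi l
                      = INR i * cos_coeff f phi l).
{ set (h := fun t => f t * cos (2 * PI * IZR l * t + phi)).
  assert (Hh : forall t, continuous h t)
    by (intros; apply mult_cos_continuous, Hc).
  assert (H1h : forall t, h (t + 1) = h t).
  { intros t; unfold h; rewrite H1; f_equal.
    rewrite <- (cos_periodic_Z l (2 * PI * IZR l * t + phi)); f_equal; ring. }
  induction i as [|i IH]; unfold cos_coeff in *.
  - rewrite (RInt_eq _ (fun _ => 0)).
    + rewrite RInt_const; change scal with Rmult; simpl; in_R; ring.
    + intros t; unfold birkhoff_sum; simpl; ring.
  - rewrite (RInt_eq _ (fun t => birkhoff_sum f alpha i t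
               * cos (2 * PI * IZR l * t + phi) + 1 * h (t + INR i * alpha))).
    + rewrite RInt_lin, IH, S_INR.
      * rewrite RInt_shift, Rplus_0_l by assumption.
        rewrite (Rplus_comm 1 (INR i * alpha)), RInt_period by assumption.
        unfold h; in_R; ring.
      * apply ex_RInt_cont; intros; apply mult_cos_continuous, Hcb.
      * apply ex_RInt_cont; intros t.
        apply (continuous_comp (fun t => t + INR i * alpha) h); [|apply Hh].
        apply continuous_of_derivable; auto_derive; exact I.
    + intros t; unfold birkhoff_sum; cbn [sum_lt]; unfold h.
      replace (2 * PI * IZR l * (t + INR i * alpha) + phi)
        with (2 * PI * IZR l * t + phi + IZR (Z.of_nat i * k) * (2 * PI)).
      * rewrite cos_periodic_Z; ring.
      * rewrite mult_IZR, <- INR_IZR_INZ, <- Hl; ring. }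
transitivity (/ INR n * cos_coeff (birkhoff_sum f alpha n) phi l).
- unfold cos_coeff; rewrite <- (RInt_scal (V := R_CompleteNormedModule)).
  + apply RInt_eq; intros t; change scal with Rmult; unfold orbit_average.
    simpl; unfold Rdiv; ring.
  + apply ex_RInt_cont; intros; apply mult_cos_continuous, Hcb.
- rewrite E; field; lra.
Qed.

(** The frequencies that are multiples of [q] are exactly those of the
    functions of period [1/q], so keeping them projects [psi] on its average
    over the rotation. *)
Lemma Psi_orbit_average (psi : R -> R) (p q : Z) (x : R) :
  (1 <= q)%Z -> rel_prime p q ->
  (forall y, ex_derive psi y) -> periodic1 psi -> RInt psi 0 1 = 0 ->
  Psi psi q x
  = RtoC (orbit_average psi (IZR p / IZR q) (Z.to_nat q) x).
Proof.
intros Hq Hpq Hd H1 H0.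
assert (Hq0 : 0 < IZR q) by (apply IZR_lt; lia).
assert (Hc : forall y, continuous psi y)
  by (intros; apply continuous_of_derivable, Hd).
set (alpha := IZR p / IZR q); set (N := Z.to_nat q).
assert (HN : INR N = IZR q) by (unfold N; rewrite INR_IZR_INZ, Z2Nat.id by lia; reflexivity).
set (avg := orbit_average psi alpha N).
assert (Hda : forall y, ex_derive avg y)
  by (intros; apply orbit_average_derivable, Hd).
assert (H1a : periodic1 avg) by (apply orbit_average_periodic1, H1).
assert (Hqa : forall y, avg (y + / IZR q) = avg y).
{ intros y; apply (periodic_inv_denominator p q avg Hq Hpq H1a).
  apply orbit_average_shift; intros z; rewrite HN.
  replace (z + IZR q * (IZR p / IZR q)) with (z + IZR p * 1) by (field; lra).
  apply periodic_Z, H1. }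
set (G := fun y => avg (y / IZR q)).
assert (HdG : forall y, ex_derive G y).
{ intros y; unfold G, Rdiv; auto_derive; auto. }
assert (H1G : periodic1 G).
{ intros y; unfold G; rewrite <- (Hqa (y / IZR q)); f_equal; field; lra. }
assert (Ecoef : forall phi n, cos_coeff G phi n = cos_coeff psi phi (n * q)).
{ intros phi n.
  rewrite <- (cos_coeff_orbit_average psi alpha phi N (n * q) (n * p)).
  - unfold cos_coeff; fold avg.
    rewrite <- (RInt_dilate (fun y => G y * cos (2 * PI * IZR n * y + phi)) q Hq).
    + apply RInt_eq; intros t; unfold G; rewrite mult_IZR.
      f_equal; f_equal; [field; lra | ring].
    + intros; apply mult_cos_continuous.
      intros; apply continuous_of_derivable, HdG.
    + intros t; rewrite H1G; f_equal.
      rewrite <- (cos_periodic_Z n (2 * PI * IZR n * t + phi)); f_equal; ring.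
  - unfold N; lia.
  - assumption.
  - assumption.
  - rewrite !mult_IZR; unfold alpha; field; lra. }
assert (EG : RInt G 0 1 = 0).
{ transitivity (RInt psi 0 1); [|exact H0].
  pose proof (Ecoef 0 0%Z) as E; unfold cos_coeff in E; simpl in E.
  rewrite (RInt_eq _ G), (RInt_eq (fun x => psi x * _) psi) in E; [exact E| |];
    intros t; replace (2 * PI * 0 * t + 0) with 0 by ring; rewrite cos_0; ring. }
pose proof (fourier_series_converges G (IZR q * x) HdG H1G) as S.
rewrite EG, Rminus_0_r in S.
replace (G (IZR q * x)) with (avg x) in S by (unfold G; f_equal; field; lra).
apply Series_Znz_unique.
replace (fun n => (fourier_coeff psi (n * q)
                   * cis (2 * PI * IZR (n * q) * x))%C)
  with (fun m => (fourier_coeff G m * cis (2 * PI * IZR m * (IZR q * x)))%C);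
  [exact S|].
apply functional_extensionality; intros n.
rewrite !fourier_coeff_cos by
  (try exact Hc; intros; apply continuous_of_derivable, HdG).
rewrite !Ecoef, mult_IZR; do 2 f_equal; ring.
Qed.

(** * Bounded Lipschitz functions *)

Lemma periodic_continuous_bounded (f : R -> R) :
  (forall x, continuous f x) -> periodic1 f ->
  exists B, 0 <= B /\ forall x, Rabs (f x) <= B.
Proof.
intros Hc H1.
destruct (continuity_ab_maj (fun x => Rabs (f x)) 0 1) as [x0 [Hx0 _]]; [lra| |].
{ intros x _; apply continuity_pt_filterlim.
  apply (continuous_comp f Rabs); [apply Hc | apply continuous_Rabs]. }
exists (Rabs (f x0)); split; [apply Rabs_pos|]; intros x.
destruct (archimed x) as [A1 A2].
rewrite <- (periodic_Z f 1 H1 (1 - up x) x).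
apply Hx0; rewrite minus_IZR; lra.
Qed.

(** One constant serves as bound and as Lipschitz constant, so that sums need
    no bookkeeping. *)
Definition bounded_lipschitz (f : R -> R) : Prop :=
  exists B, 0 <= B /\ (forall x, Rabs (f x) <= B) /\
            (forall x y, Rabs (f x - f y) <= B * Rabs (x - y)).

Lemma bounded_lipschitz_intro (f : R -> R) (B L : R) :
  0 <= B -> 0 <= L -> (forall x, Rabs (f x) <= B) ->
  (forall x y, Rabs (f x - f y) <= L * Rabs (x - y)) -> bounded_lipschitz f.
Proof.
intros HB HL H1 H2; exists (B + L); split; [lra|split]; intros x.
- specialize (H1 x); lra.
- intros y; specialize (H2 x y); assert (Hp := Rabs_pos (x - y)); nra.
Qed.

Lemma bounded_lipschitz_const (c : R) : bounded_lipschitz (fun _ => c).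
Proof.
apply (bounded_lipschitz_intro _ (Rabs c) 0); try lra; try apply Rabs_pos.
- intros; lra.
- intros x y; rewrite Rminus_diag, Rabs_R0; lra.
Qed.

Lemma bounded_lipschitz_plus (f h : R -> R) :
  bounded_lipschitz f -> bounded_lipschitz h ->
  bounded_lipschitz (fun x => f x + h x).
Proof.
intros [B [HB [Bf Lf]]] [B' [HB' [Bh Lh]]].
exists (B + B'); split; [lra|split]; intros x.
- eapply Rle_trans; [apply Rabs_triang|]; specialize (Bf x); specialize (Bh x); lra.
- intros y; replace (f x + h x - (f y + h y)) with ((f x - f y) + (h x - h y)) by ring.
  eapply Rle_trans; [apply Rabs_triang|]; specialize (Lf x y); specialize (Lh x y); lra.
Qed.

Lemma bounded_lipschitz_mult (f h : R -> R) :
  bounded_lipschitz f -> bounded_lipschitz h ->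
  bounded_lipschitz (fun x => f x * h x).
Proof.
intros [B [HB [Bf Lf]]] [B' [HB' [Bh Lh]]].
apply (bounded_lipschitz_intro _ (B * B') (2 * B * B')); [nra|nra| |]; intros x.
- rewrite Rabs_mult; apply Rmult_le_compat; auto using Rabs_pos.
- intros y; replace (f x * h x - f y * h y)
    with ((f x - f y) * h x + f y * (h x - h y)) by ring.
  eapply Rle_trans; [apply Rabs_triang|]; rewrite !Rabs_mult.
  assert (Hp := Rabs_pos (x - y)).
  assert (Rabs (f x - f y) * Rabs (h x) <= B * Rabs (x - y) * B')
    by (apply Rmult_le_compat; auto using Rabs_pos).
  assert (Rabs (f y) * Rabs (h x - h y) <= B * (B' * Rabs (x - y)))
    by (apply Rmult_le_compat; auto using Rabs_pos).
  lra.
Qed.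

Lemma bounded_lipschitz_shift (f : R -> R) (c : R) :
  bounded_lipschitz f -> bounded_lipschitz (fun x => f (x + c)).
Proof.
intros [B [HB [Bf Lf]]]; exists B; split; [assumption|split]; intros x; [apply Bf|].
intros y; replace (x - y) with (x + c - (y + c)) by ring; apply Lf.
Qed.

Lemma bounded_lipschitz_inv (f : R -> R) (m : R) :
  0 < m -> (forall x, m <= f x) -> bounded_lipschitz f ->
  bounded_lipschitz (fun x => / f x).
Proof.
intros Hm Hf [B [HB [_ Lf]]].
assert (Hi : 0 < / m) by (apply Rinv_0_lt_compat; assumption).
assert (Hle : forall x, Rabs (/ f x) <= / m).
{ intros x; specialize (Hf x).
  rewrite Rabs_pos_eq by (left; apply Rinv_0_lt_compat; lra).
  apply Rinv_le_contravar; assumption. }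
apply (bounded_lipschitz_intro _ (/ m) (/ m * / m * B)); [lra|nra|exact Hle|].
intros x y; pose proof (Hf x) as Hx; pose proof (Hf y) as Hy.
replace (/ f x - / f y) with (/ f x * / f y * (f y - f x)) by (field; lra).
rewrite !Rabs_mult, (Rabs_minus_sym (f y)).
rewrite (Rmult_assoc (/ m * / m)).
apply Rmult_le_compat; auto using Rabs_pos.
- rewrite <- Rabs_mult; apply Rabs_pos.
- apply Rmult_le_compat; auto using Rabs_pos.
Qed.

Lemma bounded_lipschitz_sum_lt (h : nat -> R -> R) (n : nat) :
  (forall j, bounded_lipschitz (h j)) ->
  bounded_lipschitz (fun x => sum_lt (fun j => h j x) n).
Proof.
intros H; induction n as [|n IH]; simpl.
- apply bounded_lipschitz_const.
- apply bounded_lipschitz_plus; auto.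
Qed.

Lemma bounded_lipschitz_birkhoff_sum (f : R -> R) (alpha : R) (n : nat) :
  bounded_lipschitz f -> bounded_lipschitz (birkhoff_sum f alpha n).
Proof.
intros H; apply (bounded_lipschitz_sum_lt (fun j x => f (x + INR j * alpha))).
intros j; apply bounded_lipschitz_shift, H.
Qed.

Lemma bounded_lipschitz_C1_periodic (f : R -> R) :
  is_C1 f -> periodic1 f -> bounded_lipschitz f.
Proof.
intros [Hd HD] H1.
assert (Hc : forall x, continuous f x)
  by (intros; apply continuous_of_derivable, Hd).
destruct (periodic_continuous_bounded f Hc H1) as [B [HB Bf]].
destruct (periodic_continuous_bounded (Derive f) HD) as [L [HL Lf]].
{ intros x; rewrite <- (Derive_ext (fun t => f (t + 1)) f x H1).
  symmetry; apply is_derive_unique; auto_derive; [apply Hd|].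
  rewrite Rmult_1_l; reflexivity. }
apply (bounded_lipschitz_intro f B L HB HL Bf); intros x y.
destruct (MVT_gen f y x (Derive f)) as [c [_ E]].
- intros; apply Derive_correct, Hd.
- intros z _; apply continuity_pt_filterlim, Hc.
- rewrite E, Rabs_mult; apply Rmult_le_compat_r; [apply Rabs_pos | apply Lf].
Qed.

Lemma bounded_lipschitz_continuous (f : R -> R) (x : R) :
  bounded_lipschitz f -> continuous f x.
Proof.
intros [B [HB [_ Lf]]]; apply continuity_pt_filterlim; intros eps Heps.
assert (Hp : 0 < eps / (B + 1)) by (apply Rdiv_lt_0_compat; lra).
exists (eps / (B + 1)); split; [assumption|].
intros y [_ Hy]; simpl in *; unfold R_dist in *.
eapply Rle_lt_trans; [apply Lf|].
apply (Rmult_lt_compat_l (B + 1)) in Hy; [|lra].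
replace ((B + 1) * (eps / (B + 1))) with eps in Hy by (field; lra).
assert (Hq := Rabs_pos (y - x)); nra.
Qed.

(** * Expansion of the rotation number *)

Lemma is_derive_primitive (w : R -> R) (x : R) :
  (forall y, continuous w y) -> is_derive (RInt w 0) x (w x).
Proof.
intros Hc; apply (is_derive_RInt (V := R_NormedModule) w (RInt w 0) 0); [|apply Hc].
apply filter_forall; intros y.
apply (RInt_correct (V := R_CompleteNormedModule)), ex_RInt_cont, Hc.
Qed.

Lemma primitive_taylor (w : R -> R) (L x h : R) :
  (forall y, continuous w y) ->
  (forall y z, Rabs (w y - w z) <= L * Rabs (y - z)) -> 0 <= L ->
  Rabs (RInt w 0 (x + h) - RInt w 0 x - h * w x) <= L * (h * h).
Proof.
intros Hc Hw HL.
destruct (MVT_gen (RInt w 0) x (x + h) w) as [c [Hcx E]].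
- intros; apply is_derive_primitive, Hc.
- intros y _; apply continuity_pt_filterlim, continuous_of_derivable.
  exists (w y); apply is_derive_primitive, Hc.
- change (RInt w 0 (x + h) - RInt w 0 x = w c * (x + h - x)) in E.
  rewrite E; replace (w c * (x + h - x) - h * w x) with (h * (w c - w x)) by ring.
  assert (Hch : Rabs (c - x) <= Rabs h).
  { unfold Rmin, Rmax in Hcx; destruct (Rle_dec x (x + h));
      unfold Rabs; destruct (Rcase_abs (c - x)); destruct (Rcase_abs h); lra. }
  rewrite Rabs_mult.
  replace (h * h) with (Rabs h * Rabs h) by (rewrite <- Rabs_mult; apply Rabs_pos_eq; nra).
  assert (Hp := Rabs_pos h); specialize (Hw c x).
  assert (Rabs (w c - w x) <= L * Rabs h) by nra; nra.
Qed.

(** Along an orbit [Theta] grows by [c] per step up to [eps], and it stays at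
    bounded distance from [T] times the position, which grows by
    [rotation_number F] per step on average. *)
Lemma rotation_number_potential (F : R -> R) (Theta : R -> R) (T B c eps : R) :
  is_lift F ->
  (forall y, Rabs (Theta y - T * y) <= B) ->
  (forall y, Rabs (Theta (F y) - Theta y - c) <= eps) ->
  Rabs (T * rotation_number F - c) <= eps.
Proof.
intros HF HB Hstep.
assert (Hn : forall n, Rabs (Theta (Nat.iter n F 0) - Theta 0 - INR n * c)
                       <= INR n * eps).
{ induction n as [|n IH].
  - simpl; rewrite !Rmult_0_l, Rminus_diag, Rminus_0_r, Rabs_R0; lra.
  - rewrite S_INR; cbn [Nat.iter].
    specialize (Hstep (Nat.iter n F 0)).
    apply Rabs_le_between in IH; apply Rabs_le_between in Hstep.
    apply Rabs_le; simpl; lra. }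
assert (Hinv : is_lim_seq (fun n => / INR n) 0).
{ apply (is_lim_seq_inv INR p_infty); [apply is_lim_seq_INR | discriminate]. }
apply (is_lim_seq_le_loc
  (fun n => Rabs (T * ((Nat.iter n F 0 - 0) / INR n) - c))
  (fun n => eps + 2 * B * / INR n)
  (Rabs (T * rotation_number F - c)) eps).
- exists 1%nat; intros n Hn1.
  apply le_INR in Hn1; simpl in Hn1.
  specialize (Hn n); pose proof (HB (Nat.iter n F 0)) as B1; pose proof (HB 0) as B0.
  assert (Hi : 0 < / INR n) by (apply Rinv_0_lt_compat; lra).
  replace (T * ((Nat.iter n F 0 - 0) / INR n) - c)
    with ((T * Nat.iter n F 0 - INR n * c) * / INR n) by (field; lra).
  replace (eps + 2 * B * / INR n) with ((INR n * eps + 2 * B) * / INR n)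
    by (field; lra).
  rewrite Rabs_mult, (Rabs_pos_eq (/ INR n)) by lra.
  apply Rmult_le_compat_r; [lra|].
  apply Rabs_le_between in Hn; apply Rabs_le_between in B1.
  apply Rabs_le_between in B0; apply Rabs_le; lra.
- apply (is_lim_seq_abs _ (T * rotation_number F - c)).
  apply is_lim_seq_minus'; [|apply is_lim_seq_const].
  apply (is_lim_seq_scal_l _ T (rotation_number F)).
  apply (rotation_number_correct F HF 0).
- replace (Finite eps) with (Finite (eps + 2 * B * 0)) by (f_equal; ring).
  apply is_lim_seq_plus'; [apply is_lim_seq_const|].
  apply (is_lim_seq_scal_l _ (2 * B) 0), Hinv.
Qed.

(** The increment of the primitive over [p/q] is constant, and [q] times it is
    the increment over [p], that is [p] periods. *)
Lemma primitive_rational_shift (w : R -> R) (p q : Z) (x : R) :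
  (1 <= q)%Z -> (forall y, continuous w y) -> periodic1 w ->
  (forall y, w (y + IZR p / IZR q) = w y) ->
  RInt w 0 (x + IZR p / IZR q) = RInt w 0 x + IZR p / IZR q * RInt w 0 1 :> R.
Proof.
intros Hq Hc H1 Hr.
assert (Hq0 : 0 < IZR q) by (apply IZR_lt; lia).
set (alpha := IZR p / IZR q) in *.
rewrite (RInt_quasi_periodic w alpha x Hc Hr); f_equal.
pose proof (quasi_periodic_Z (RInt w 0) alpha (RInt w 0 alpha)
  (fun y => RInt_quasi_periodic w alpha y Hc Hr) q 0) as Eq.
pose proof (quasi_periodic_Z (RInt w 0) 1 (RInt w 0 1)
  (fun y => RInt_quasi_periodic w 1 y Hc H1) p 0) as Ep.
replace (0 + IZR q * alpha) with (0 + IZR p * 1) in Eq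
  by (unfold alpha; field; lra).
rewrite Ep in Eq; apply (Rmult_eq_reg_l (IZR q)); [|lra].
transitivity (IZR p * RInt w 0 1); [lra|unfold alpha; field; lra].
Qed.

(** The potential is [Theta = Phi + mu z] with [z = u w].  Writing the image
    of [y] as [y + alpha + mu v], the first-order gain of [Phi] is
    [mu w (a + psi)] and that of [mu z] is [mu w (avg - psi)]; their sum is
    exactly [mu].  All other terms are [O(mu^2)] with bounded Lipschitz data. *)
Lemma rotation_number_expansion (p q : Z) (F : R -> R -> R) (mu0 a m : R)
    (psi : R -> R) (g : R -> R -> R) :
  (1 <= q)%Z -> in_class_R p q F mu0 a psi g ->
  0 < m -> (forall x, m <= a + psi x) ->
  let T := RInt (fun x =>
    / (a + orbit_average psi (IZR p / IZR q) (Z.to_nat q) x)) 0 1 in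
  exists K, 0 <= K /\ forall mu, Rabs mu < mu0 -> Rabs mu <= 1 ->
    Rabs (T * rotation_number (fun x => F x mu)
          - (IZR p / IZR q * T + mu)) <= K * (mu * mu).
Proof.
intros Hq HF Hm Hpos T.
destruct HF as [_ Hmu0 Hlift Hexp HC1 H1 _ [M HM] _ _ _].
assert (Hq0 : 0 < IZR q) by (apply IZR_lt; lia).
set (alpha := IZR p / IZR q) in *; set (N := Z.to_nat q) in *.
assert (HN : INR N = IZR q)
  by (unfold N; rewrite INR_IZR_INZ, Z2Nat.id by lia; reflexivity).
assert (HN0 : (0 < N)%nat) by (unfold N; lia).
set (avg := orbit_average psi alpha N) in *.
assert (Hpsi : bounded_lipschitz psi) by (apply bounded_lipschitz_C1_periodic; assumption).
assert (Havg_r : forall y, avg (y + alpha) = avg y).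
{ apply orbit_average_shift; intros z; rewrite HN.
  replace (z + IZR q * alpha) with (z + IZR p * 1) by (unfold alpha; field; lra).
  apply periodic_Z, H1. }
assert (Havg1 : periodic1 avg) by (apply orbit_average_periodic1, H1).
assert (Havgm : forall y, m <= a + avg y)
  by (intros; apply add_orbit_average_ge; assumption).
assert (Havg : bounded_lipschitz (fun y => a + avg y)).
{ apply bounded_lipschitz_plus; [apply bounded_lipschitz_const|].
  apply (bounded_lipschitz_mult (birkhoff_sum psi alpha N) (fun _ => / INR N));
    [apply bounded_lipschitz_birkhoff_sum, Hpsi | apply bounded_lipschitz_const]. }
set (w := fun y => / (a + avg y)) in *.
assert (Hw : bounded_lipschitz w) by (apply (bounded_lipschitz_inv _ m); assumption).
assert (Hwr : forall y, w (y + alpha) = w y) by (intros; unfold w; rewrite Havg_r; reflexivity).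
assert (Hw1 : periodic1 w) by (intros y; unfold w; rewrite Havg1; reflexivity).
assert (Hwc : forall y, continuous w y) by (intros; apply bounded_lipschitz_continuous, Hw).
set (u := transfer psi alpha N).
assert (Hu : bounded_lipschitz u).
{ apply (bounded_lipschitz_mult (fun y => sum_lt (fun j => birkhoff_sum psi alpha j y) N)
    (fun _ => / INR N)); [|apply bounded_lipschitz_const].
  apply bounded_lipschitz_sum_lt; intros; apply bounded_lipschitz_birkhoff_sum, Hpsi. }
set (z := fun y => u y * w y).
assert (Hz : bounded_lipschitz z) by (apply bounded_lipschitz_mult; assumption).
assert (Hcoh : forall y, z (y + alpha) - z y = w y * (avg y - psi y)).
{ intros y; unfold z; rewrite Hwr; unfold avg.
  rewrite <- transfer_cohomological by assumption; fold u; ring. }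
set (Phi := RInt w 0).
assert (HPhi : forall y, Phi (y + alpha) = Phi y + alpha * T)
  by (intros; apply primitive_rational_shift; assumption).
destruct (periodic_continuous_bounded (fun y => Phi y - T * y)) as [B [_ HB]].
{ intros y; apply continuous_of_derivable.
  apply (ex_derive_minus (V := R_NormedModule) Phi (fun y => T * y)).
  - exists (w y); apply is_derive_primitive, Hwc.
  - auto_derive; exact I. }
{ intros y; unfold Phi; rewrite RInt_quasi_periodic by assumption.
  fold T; ring. }
destruct Hpsi as [P [HP [BP _]]].
destruct Hw as [W [HW [BW LW]]]; destruct Hz as [Z [HZ [BZ LZ]]].
assert (HM0 : 0 <= M).
{ specialize (HM 0 0); rewrite Rabs_R0 in HM; specialize (HM Hmu0).
  assert (Hp := Rabs_pos (g 0 0)); lra. }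
(* [V] bounds the displacement per unit of [mu]. *)
set (V := Rabs a + P + M).
assert (HV : 0 <= V) by (assert (Hp := Rabs_pos a); unfold V; lra).
(* Taylor remainder of [Phi], Lipschitz error of [z], and the term in [g]. *)
exists (W * (V * V) + Z * V + M * W); split.
{ assert (0 <= V * V) by nra. nra. }
intros mu Hmu Hmu1.
apply (rotation_number_potential _ (fun y => Phi y + mu * z y) T (B + Z)).
- apply Hlift, Hmu.
- intros y; replace (Phi y + mu * z y - T * y) with ((Phi y - T * y) + mu * z y) by ring.
  eapply Rle_trans; [apply Rabs_triang|]; rewrite Rabs_mult.
  specialize (HB y); specialize (BZ y).
  assert (Hp := Rabs_pos (z y)); assert (Hp' := Rabs_pos mu); nra.
- intros y; rewrite (Hexp y mu Hmu).
  set (v := a + psi y + mu * g y mu).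
  replace (y + alpha + mu * (a + psi y) + mu ^ 2 * g y mu)
    with (y + alpha + mu * v) by (unfold v; ring).
  assert (Hv : Rabs v <= V).
  { unfold v, V; eapply Rle_trans; [apply Rabs_triang|].
    apply Rplus_le_compat.
    - eapply Rle_trans; [apply Rabs_triang|]; specialize (BP y); lra.
    - rewrite Rabs_mult; specialize (HM y mu Hmu).
      assert (Hp := Rabs_pos (g y mu)); assert (Hp' := Rabs_pos mu); nra. }
  pose proof (primitive_taylor w W (y + alpha) (mu * v) Hwc LW HW) as E1.
  fold Phi in E1; rewrite Hwr, HPhi in E1.
  pose proof (LZ (y + alpha + mu * v) (y + alpha)) as E2.
  replace (y + alpha + mu * v - (y + alpha)) with (mu * v) in E2 by ring.
  rewrite Rabs_mult in E2.
  specialize (Hcoh y); specialize (Havgm y).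
  assert (Ew : w y * (a + psi y) + w y * (avg y - psi y) = 1)
    by (unfold w; field; lra).
  replace (Phi (y + alpha + mu * v) + mu * z (y + alpha + mu * v)
           - (Phi y + mu * z y) - (alpha * T + mu))
    with ((Phi (y + alpha + mu * v) - (Phi y + alpha * T) - mu * v * w y)
          + mu * (z (y + alpha + mu * v) - z (y + alpha))
          + mu * mu * (g y mu * w y)).
  + set (e1 := Phi (y + alpha + mu * v) - (Phi y + alpha * T) - mu * v * w y) in *.
    set (e2 := z (y + alpha + mu * v) - z (y + alpha)) in *.
    assert (Hmm : Rabs mu * Rabs mu = mu * mu)
      by (rewrite <- Rabs_mult; apply Rabs_pos_eq; nra).
    assert (Hvv : v * v <= V * V)
      by (apply Rabs_le_between in Hv; nra).
    assert (Hmu2 : 0 <= mu * mu) by nra.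
    assert (A1 : Rabs e1 <= W * (V * V) * (mu * mu)).
    { eapply Rle_trans; [exact E1|].
      replace (mu * v * (mu * v)) with (mu * mu * (v * v)) by ring.
      assert (mu * mu * (v * v) <= mu * mu * (V * V))
        by (apply Rmult_le_compat_l; assumption).
      nra. }
    assert (A2 : Rabs (mu * e2) <= Z * V * (mu * mu)).
    { rewrite Rabs_mult, <- Hmm.
      assert (Hp := Rabs_pos mu).
      assert (Rabs mu * Rabs e2 <= Rabs mu * (Z * (Rabs mu * V))).
      { apply Rmult_le_compat_l; [assumption|].
        eapply Rle_trans; [exact E2|].
        apply Rmult_le_compat_l; [assumption|].
        apply Rmult_le_compat_l; assumption. }
      lra. }
    assert (A3 : Rabs (mu * mu * (g y mu * w y)) <= M * W * (mu * mu)).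
    { rewrite Rabs_mult, (Rabs_pos_eq (mu * mu)), Rabs_mult by assumption.
      rewrite Rmult_comm; apply Rmult_le_compat_r; [assumption|].
      apply Rmult_le_compat; auto using Rabs_pos. }
    eapply Rle_trans; [apply Rabs_triang|].
    eapply Rle_trans; [apply Rplus_le_compat_r, Rabs_triang|].
    lra.
  + replace (z y) with (z (y + alpha) - w y * (avg y - psi y)) by lra.
    replace (alpha * T + mu)
      with (alpha * T + mu * (w y * (a + psi y) + w y * (avg y - psi y)))
      by (rewrite Ew; ring).
    unfold v; ring.
Qed.

Lemma T0_RInt (a m : R) (psi : R -> R) (p q : Z) :
  (1 <= q)%Z -> rel_prime p q ->
  (forall y, ex_derive psi y) -> periodic1 psi -> RInt psi 0 1 = 0 ->
  0 < m -> (forall x, m <= a + psi x) ->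
  T0 a psi q = RtoC (RInt (fun x =>
    / (a + orbit_average psi (IZR p / IZR q) (Z.to_nat q) x)) 0 1).
Proof.
intros Hq Hpq Hd H1 H0 Hm Hpos.
set (avg := orbit_average psi (IZR p / IZR q) (Z.to_nat q)).
assert (Havg : forall y, m <= a + avg y)
  by (intros; apply add_orbit_average_ge; [lia | assumption]).
transitivity (CInt (fun x => (/ (a + avg x), 0)) 0 1).
- unfold T0, CInt; apply (RInt_ext (V := C_R_CompleteNormedModule)); intros x _.
  rewrite (Psi_orbit_average psi p q x) by assumption; fold avg.
  specialize (Havg x).
  unfold Cdiv; rewrite Cmult_1_l, <- RtoC_plus, <- RtoC_inv by lra; reflexivity.
- rewrite CInt_pair.
  + rewrite (RInt_const (V := R_CompleteNormedModule)); unfold RtoC; f_equal.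
    apply Rmult_0_r.
  + intros x; apply continuous_of_derivable.
    apply (ex_derive_inv (fun x => a + avg x)); [|specialize (Havg x); lra].
    apply (ex_derive_plus (V := R_NormedModule) (fun _ => a) avg);
      [apply ex_derive_const | apply orbit_average_derivable, Hd].
  + intros; apply continuous_const.
Qed.

(** Taking [mu = 0] shows that [r 0 = c]; the difference quotient then differs
    from [1/T] by at most [K |mu| / T]. *)
Lemma is_derive_quadratic_error (r : R -> R) (delta T c K : R) :
  0 < delta -> 0 < T -> 0 <= K ->
  (forall mu, Rabs mu < delta ->
     Rabs (T * r mu - (c * T + mu)) <= K * (mu * mu)) ->
  is_derive r 0 (/ T).
Proof.
intros Hdelta HT HK H; apply is_derive_Reals; intros eps Heps.
assert (Hr0 : T * r 0 = c * T).
{ specialize (H 0); rewrite Rabs_R0 in H; specialize (H Hdelta).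
  rewrite Rmult_0_r, Rmult_0_r, Rplus_0_r in H.
  apply Rabs_le_between in H; lra. }
assert (Hp : 0 < eps * T / (K + 1)) by (apply Rdiv_lt_0_compat; nra).
assert (Hmin : 0 < Rmin delta (eps * T / (K + 1))) by (apply Rmin_pos; assumption).
exists (mkposreal _ Hmin); intros h Hh0 Hh; simpl in Hh.
pose proof (Rlt_le_trans _ _ _ Hh (Rmin_l _ _)) as Hh1.
pose proof (Rlt_le_trans _ _ _ Hh (Rmin_r _ _)) as Hh2.
specialize (H h Hh1); rewrite Rplus_0_l.
assert (Hah : 0 < Rabs h) by (apply Rabs_pos_lt; assumption).
replace ((r h - r 0) / h - / T)
  with ((T * r h - (c * T + h)) * / (T * h))
  by (rewrite <- Hr0; field; lra).
rewrite Rabs_mult, Rabs_inv, (Rabs_mult T h), (Rabs_pos_eq T) by lra.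
apply (Rmult_lt_reg_r (T * Rabs h)); [nra|].
rewrite Rmult_assoc, Rinv_l, Rmult_1_r by nra.
eapply Rle_lt_trans; [exact H|].
replace (h * h) with (Rabs h * Rabs h) by (rewrite <- Rabs_mult; apply Rabs_pos_eq; nra).
apply (Rmult_lt_compat_l (K + 1)) in Hh2; [|lra].
replace ((K + 1) * (eps * T / (K + 1))) with (eps * T) in Hh2 by (field; lra).
nra.
Qed.

Theorem corollary1p4 (p q : Z) (F : R -> R -> R) (mu0 a : R)
    (psi : R -> R) (g : R -> R -> R)
    (Hq : (1 <= q)%Z)
    (HF : in_class_R p q F mu0 a psi g)
    (Ha : 0 < a)
    (m : R) (Hm : is_min_on (fun x => a + psi x) 0 1 m) (Hmpos : 0 < m) :
  exists d : R,
    is_derive (fun mu => rotation_number (fun x => F x mu)) 0 d /\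
    RtoC d = (/ T0 a psi q)%C.
Proof.
assert (Hpos : forall x, m <= a + psi x).
{ intros x; destruct (archimed x) as [A1 A2].
  rewrite <- (periodic_Z psi 1 (class_psi_periodic _ _ _ _ _ _ _ HF) (1 - up x) x).
  apply (proj2 Hm); rewrite minus_IZR; lra. }
destruct (rotation_number_expansion p q F mu0 a m psi g Hq HF Hmpos Hpos)
  as [K [HK HE]].
pose proof HF as [Hpq Hmu0 _ _ [Hd HD] H1 H0 _ _ _ _].
rewrite (T0_RInt a m psi p q) by assumption.
set (w := fun x => / (a + orbit_average psi (IZR p / IZR q) (Z.to_nat q) x)) in *.
assert (Havg : forall y,
  0 < a + orbit_average psi (IZR p / IZR q) (Z.to_nat q) y).
{ intros y; apply (Rlt_le_trans _ m); [assumption|].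
  apply add_orbit_average_ge; [lia | assumption]. }
assert (HT : 0 < RInt w 0 1).
{ apply RInt_gt_0; [lra| |].
  - intros x _; apply Rinv_0_lt_compat, Havg.
  - intros x _; apply continuous_of_derivable.
    apply (ex_derive_inv (fun x => a + orbit_average psi _ _ x));
      [|specialize (Havg x); lra].
    apply (ex_derive_plus (V := R_NormedModule) (fun _ => a));
      [apply ex_derive_const | apply orbit_average_derivable, Hd]. }
exists (/ RInt w 0 1); split; [|apply RtoC_inv; lra].
apply (is_derive_quadratic_error _ (Rmin mu0 1) _ (IZR p / IZR q) K);
  [apply Rmin_pos; lra | assumption | assumption |].
intros mu Hmu.
pose proof (Rlt_le_trans _ _ _ Hmu (Rmin_l _ _)).
pose proof (Rlt_le_trans _ _ _ Hmu (Rmin_r _ _)).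
apply HE; lra.
Qed.
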